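(* Fix $\Gamma z_0\in\mathcal M$. Let $\{y_n\}_{n\in\mathbb N}$ be positive numbers with $y_n\asymp 1/(n^2\log^\beta n)$ for some fixed $0<\beta<2$. Then for Lebesgue-almost every $x\in\mathbb R/\mathbb Z$, $$\limsup_{n\to\infty}\frac{\inf_{\Gamma z\in\mathcal R_n(x,y_n)}d_{\mathcal M}(\Gamma z_0,\Gamma z)}{\log\log n}\ge\min\{\beta,2-\beta\}.$$
   Context: $\mathcal M=\Gamma\backslash\mathbb H$ with $\Gamma=\mathrm{SL}_2(\mathbb Z)$, and $d_{\mathcal M}(\Gamma z_1,\Gamma z_2)=\inf_{\gamma\in\Gamma}d_{\mathbb H}(\gamma z_1,z_2)$, with $d_{\mathbb H}$ the hyperbolic distance for the metric $|dz|/\mathrm{Im}(z)$. $\mathcal R_n(x,y)=\{\Gamma(x+\tfrac jn+iy):0\le j\le n-1\}$. $A\asymp B$ means $A\ll B\ll A$. *)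

(* Defs.v *)
From HB Require Import structures.
From mathcomp Require Import all_boot all_order all_algebra.
From mathcomp Require Import all_classical all_reals all_analysis.
Set Implicit Arguments. Unset Strict Implicit. Unset Printing Implicit Defensive.
Import Order.TTheory GRing.Theory Num.Theory.
Local Open Scope classical_set_scope.
Local Open Scope ring_scope.

(* Points of the upper half plane H are represented as pairs (x, y) : R * R,
   meaning z = x + i y; membership in H is y > 0. *)
Definition inH {R : realType} (z : R * R) : Prop := 0 < z.2.

Definition acosh {R : realType} (t : R) : R := ln (t + Num.sqrt (t ^+ 2 - 1)).

(* hyperbolic distance on H for the metric |dz|/Im z:
   d(z,w) = arcosh (1 + |z - w|^2 / (2 Im z Im w)) *)
Definition dH {R : realType} (z w : R * R) : R :=
  acosh (1 + ((z.1 - w.1) ^+ 2 + (z.2 - w.2) ^+ 2) / (2 * z.2 * w.2)).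

Definition SL2Z : set (int * int * int * int) :=
  [set g | let: (a, b, c, d) := g in a * d - b * c = 1].

(* Moebius action  z |-> (a z + b) / (c z + d), in real coordinates *)
Definition act {R : realType} (g : int * int * int * int) (z : R * R) : R * R :=
  let: (a, b, c, d) := g in
  let a' := (a%:~R : R) in let b' := (b%:~R : R) in
  let c' := (c%:~R : R) in let d' := (d%:~R : R) in
  let den := (c' * z.1 + d') ^+ 2 + (c' * z.2) ^+ 2 in
  (((a' * z.1 + b') * (c' * z.1 + d') + a' * c' * z.2 ^+ 2) / den,
   z.2 / den).

(* distance on M = Gamma \ H between the orbits of z1 and z2 *)
Definition dM {R : realType} (z1 z2 : R * R) : R :=
  inf [set dH (act g z1) z2 | g in SL2Z].

Definition Rn {R : realType} (n : nat) (x y : R) : set (R * R) :=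
  [set (x + j%:R / n%:R, y) | j in [set j : nat | (j < n)%N]].

Definition distRn {R : realType} (z0 : R * R) (n : nat) (x y : R) : R :=
  inf [set dM z0 z | z in Rn n x y].

(* Main.v *)
(* If |x - m/n| < 1/(n^2 log n), then every translate x + j/n is as close to the
   rational (m + j)/n of denominator n, so a (not necessarily integral)
   unimodular matrix with bottom row (n, -(m + j)) lifts each point of R_n(x, y_n)
   to height >> (log n)^min(beta, 2 - beta), while it keeps the whole orbit of
   z_0 at bounded height.  The distance is then at least the logarithm of that
   height up to O(1).

   That almost every x has infinitely many such approximations is the divergence
   case of Khinchin's theorem.  By Lebesgue density it suffices that the good set
   fills a fixed proportion of every short Farey interval I around x.  In I the
   fractions of denominator at most N are 1/N^2-separated and at least N^2 |I|/16
   in number, so as long as the balls collected at previous scales have small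
   total measure, most cells of the scale N are untouched and adding their balls
   increases the measure by a multiple of |I|/log N.  Over geometric N these
   gains form a harmonic series. *)
Require Import Defs.
From HB Require Import structures.
From mathcomp Require Import all_boot all_order all_algebra.
From mathcomp Require Import all_classical all_reals all_analysis.
From mathcomp Require Import measurable_realfun ring lra zify.
Import Order.TTheory GRing.Theory Num.Theory.
Local Open Scope classical_set_scope.
Local Open Scope ring_scope.
Import numFieldNormedType.Exports.

(** * Heights of points and lower bounds for the hyperbolic distance *)

Lemma ln_le_acosh {R : realType} (t : R) : 0 < t -> ln t <= acosh t.
Proof.
by move=> t0; rewrite /acosh ler_ln ?posrE ?ltr_pwDl ?lerDl ?sqrtr_ge0.
Qed.

(* [z.2 / cusp_norm q p z] is the imaginary part of the image of [z] under any
   real unimodular matrix with bottom row [(q, -p)]. *)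
Definition cusp_norm {R : realType} (q p : R) (z : R * R) : R :=
  (q * z.1 - p) ^+ 2 + (q * z.2) ^+ 2.

(* [cosh d(w, z) >= (1/2) Im (g z) / Im (g w)] for [g] with bottom row [(q, -p)]. *)
Lemma cusp_norm_le {R : realType} (q p : R) (w z : R * R) :
  z.2 ^+ 2 * cusp_norm q p w <=
  ((w.1 - z.1) ^+ 2 + w.2 ^+ 2 + z.2 ^+ 2) * cusp_norm q p z.
Proof.
rewrite -subr_ge0 /cusp_norm.
have -> : ((w.1 - z.1) ^+ 2 + w.2 ^+ 2 + z.2 ^+ 2) * ((q * z.1 - p) ^+ 2 + (q * z.2) ^+ 2) -
   z.2 ^+ 2 * ((q * w.1 - p) ^+ 2 + (q * w.2) ^+ 2) =
   ((q * z.1 - p) * (w.1 - z.1) - q * z.2 ^+ 2) ^+ 2 + (w.2 * (q * z.1 - p)) ^+ 2 by ring.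
by rewrite addr_ge0 ?sqr_ge0.
Qed.

Lemma cusp_norm_gt0 {R : realType} (q p : R) (z : R * R) :
  inH z -> q != 0 -> 0 < cusp_norm q p z.
Proof.
move=> z0 q0; rewrite ltr_wpDl ?sqr_ge0 // exprn_even_gt0 //=.
by rewrite mulf_neq0 // gt_eqF.
Qed.

Lemma ln_le_dH {R : realType} (q p : R) (w z : R * R) : inH w -> inH z -> q != 0 ->
  ln (z.2 * cusp_norm q p w / (2 * w.2 * cusp_norm q p z)) <= dH w z.
Proof.
move=> w0 z0 q0; have w0' : 0 < w.2 := w0; have z0' : 0 < z.2 := z0.
have nw := cusp_norm_gt0 q p w w0 q0; have nz := cusp_norm_gt0 q p z z0 q0.
apply: le_trans (ln_le_acosh _ _); last first.
  by rewrite ltr_pwDl // divr_ge0 ?addr_ge0 ?sqr_ge0 // !mulr_ge0 // ltW.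
have E : 1 + ((w.1 - z.1) ^+ 2 + (w.2 - z.2) ^+ 2) / (2 * w.2 * z.2) =
   ((w.1 - z.1) ^+ 2 + w.2 ^+ 2 + z.2 ^+ 2) / (2 * w.2 * z.2).
  by field; rewrite !gt_eqF.
rewrite E ler_ln ?posrE ?divr_gt0 ?mulr_gt0 //; last first.
  by rewrite ltr_wpDl ?exprn_gt0 // addr_ge0 ?sqr_ge0.
have := cusp_norm_le q p w z; move: (cusp_norm q p w) (cusp_norm q p z) nw nz => a b a0 b0 le.
rewrite ler_pdivrMr ?mulr_gt0 // mulrAC ler_pdivlMr ?mulr_gt0 //.
rewrite (_ : _ * _ * (2 * w.2 * z.2) = (z.2 ^+ 2 * a) * (2 * w.2)); last by ring.
rewrite (_ : _ * (2 * w.2 * b) = ((w.1 - z.1) ^+ 2 + w.2 ^+ 2 + z.2 ^+ 2) * b * (2 * w.2));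
  last by ring.
by rewrite ler_wpM2r // mulr_ge0 // ltW.
Qed.

Lemma inH_act {R : realType} (g : int * int * int * int) (z : R * R) :
  SL2Z g -> inH z -> inH (act g z).
Proof.
case: g => [[[a b] c] d] /= det z0; apply: divr_gt0 => //.
have [c0|c0] := eqVneq c 0.
  rewrite ltr_pwDl ?sqr_ge0 // exprn_even_gt0 //= c0 mul0r add0r intr_eq0.
  by apply/eqP => d0; move: det; rewrite c0 d0 !mulr0 subrr.
rewrite ltr_wpDl ?sqr_ge0 // exprn_even_gt0 //= mulf_neq0 ?intr_eq0 //.
by rewrite gt_eqF.
Qed.

(** The row [(q, -p)] times the matrix of the action is [(q a - p c, q b - p d)]. Two expressions
    for the height of the image of [z] under the composite map are equated and cross-multiplied. *)
Lemma cusp_norm_act {R : realType} (a b c d q p : int) (z : R * R) :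
  inH z -> a * d - b * c = 1 ->
  (act (a, b, c, d) z).2 * cusp_norm (q * a - p * c)%:~R (p * d - q * b)%:~R z =
  z.2 * cusp_norm q%:~R p%:~R (act (a, b, c, d) z).
Proof.
move=> z0 det; have detR : a%:~R * d%:~R - b%:~R * c%:~R = 1 :> R.
  by rewrite -!intrM -intrB det.
have := inH_act (a, b, c, d) z det z0.
rewrite /inH /cusp_norm /= !intrB !intrM => den0.
have {}den0 : (c%:~R * z.1 + d%:~R) ^+ 2 + (c%:~R * z.2) ^+ 2 != 0 :> R.
  by apply/eqP => E; move: den0; rewrite E invr0 mulr0 ltxx.
(* Inserting the determinant as a factor turns the goal into a rational identity that [field] can
   check. *)
have E : z.2 / ((c%:~R * z.1 + d%:~R) ^+ 2 + (c%:~R * z.2) ^+ 2) =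
   z.2 * (a%:~R * d%:~R - b%:~R * c%:~R) / ((c%:~R * z.1 + d%:~R) ^+ 2 + (c%:~R * z.2) ^+ 2).
  by rewrite detR mulr1.
by rewrite {2}E; field.
Qed.

(** This keeps the orbit of $z_0$ at bounded height: the norm is [d ^+ 2 >= 1] when [c = 0], and at
    least [z.2 ^+ 2] otherwise. *)
Lemma im_div_cusp_norm_le {R : realType} (c d : int) (z : R * R) :
  inH z -> (c != 0) || (d != 0) ->
  z.2 <= Num.max z.2 z.2^-1 * cusp_norm c%:~R d%:~R z.
Proof.
move=> z0; have z0' : 0 < z.2 := z0.
have sqr_ge1 (k : int) : k != 0 -> 1 <= k%:~R ^+ 2 :> R.
  by move=> k0; rewrite -rmorphXn -[1]/(1%:~R) ler_int -gtz0_ge1 exprn_even_gt0.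
have [->/= d0|c0 _] := eqVneq c 0.
  apply: (@le_trans _ _ (z.2 * 1)); first by rewrite mulr1.
  rewrite ler_pM ?(ltW z0') // ?le_max ?lexx // /cusp_norm mulr0z !mul0r sub0r sqrrN.
  by rewrite expr0n /= addr0 sqr_ge1.
apply: (@le_trans _ _ (z.2^-1 * z.2 ^+ 2)); first by rewrite expr2 mulKf ?gt_eqF.
rewrite ler_pM ?invr_ge0 ?sqr_ge0 ?(ltW z0') // ?le_max ?lexx ?orbT //.
rewrite /cusp_norm ler_wpDl ?sqr_ge0 // exprMn.
by rewrite ler_peMl ?sqr_ge0 ?sqr_ge1.
Qed.

(** The product of [(q, -p)] with any element of [SL2Z] is a nonzero integer row. Hence all points
    of the orbit of [z0] obey the same height bound, and [ln_le_dH] bounds every member of the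
    infimum uniformly. *)
Lemma ln_le_dM {R : realType} (q p : int) (z0 z : R * R) : inH z0 -> inH z -> q != 0 ->
  ln (z.2 / (2 * Num.max z0.2 z0.2^-1 * cusp_norm q%:~R p%:~R z)) <= dM z0 z.
Proof.
move=> hz0 hz q0; have z00 : 0 < z0.2 := hz0; have z20 : 0 < z.2 := hz.
apply: lb_le_inf; first by exists (dH (act (1, 0, 0, 1) z0) z); exists (1, 0, 0, 1).
move=> _ [[[[a b] c] d] /= det <-].
have hw := inH_act (a, b, c, d) z0 det hz0.
have w0 : 0 < (act (a, b, c, d) z0).2 := hw.
have qR : q%:~R != 0 :> R by rewrite intr_eq0.
have h0 : 0 < Num.max z0.2 z0.2^-1 by rewrite lt_max z00.
have nw := cusp_norm_gt0 q%:~R p%:~R _ hw qR.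
have nz := cusp_norm_gt0 q%:~R p%:~R _ hz qR.
apply: le_trans (ln_le_dH q%:~R p%:~R _ _ hw hz qR).
(* Multiplying the row back by the inverse matrix recovers [q], so a vanishing row would force
   [q = 0]. *)
have cd : (q * a - p * c != 0) || (p * d - q * b != 0).
  rewrite -negb_and; apply: contraNN q0 => /andP[/eqP e1 /eqP e2]; apply/eqP.
  transitivity ((q * a - p * c) * d + (p * d - q * b) * c); last by rewrite e1 e2 !mul0r addr0.
  by rewrite -[LHS]mulr1 -det; ring.
have := im_div_cusp_norm_le _ _ z0 hz0 cd.
have := cusp_norm_act a b c d q p z0 hz0 det.
move: (cusp_norm _ _ z0) (cusp_norm _ _ (act _ _)) (cusp_norm _ _ z) nw nz w0 h0.
move: (Num.max _ _) (act _ _).2 => m w u v t v0 t0 w0 m0 E le.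
rewrite ler_ln ?posrE ?divr_gt0 ?mulr_gt0 //.
rewrite ler_pdivrMr ?mulr_gt0 // mulrAC ler_pdivlMr ?mulr_gt0 //.
have : w * z0.2 <= m * (z0.2 * v) by rewrite -E mulrCA ler_pM2l.
rewrite (mulrC w) mulrCA ler_pM2l // => H.
rewrite (_ : z.2 * (2 * w * t) = (2 * z.2 * t) * w); last by ring.
rewrite (_ : z.2 * v * (2 * m * t) = (2 * z.2 * t) * (m * v)); last by ring.
by rewrite ler_pM2l ?mulr_gt0.
Qed.

(** * Counting coprime pairs in a box *)

Definition coprime_pairs (X Y : nat) : seq (nat * nat) :=
  [seq ab <- [seq (a, b) | a <- iota 1 X, b <- iota 1 Y] | coprime ab.1 ab.2].

(** From [d = 3] on the terms telescope through $1/d^2 \le 1/(d-1) - 1/d$. Keeping the first term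
    $1/4$ exact holds the total below $3/4$, which leaves a quarter of the box to the coprime
    pairs. *)
Lemma sum_inv_sqr_le (n : nat) :
  \sum_(2 <= d < n.+3) (d%:R ^- 2 : rat) <= 3 / 4 - n.+2%:R^-1.
Proof.
elim: n => [|n IH]; first by rewrite big_nat1.
rewrite big_nat_recr //=.
have : (n.+3%:R ^- 2 : rat) <= n.+2%:R^-1 - n.+3%:R^-1.
  have n2 : (0 : rat) < n.+2%:R by [].
  have -> : n.+3%:R = n.+2%:R + 1 :> rat by rewrite natr1.
  move: n.+2%:R n2 => u n2.
  have -> : u^-1 - (u + 1)^-1 = (u * (u + 1))^-1 by field; apply/andP; split; lra.
  have u1 : 0 < u + 1 by lra.
  rewrite lef_pV2 ?posrE ?exprn_gt0 ?mulr_gt0 // expr2 ler_pM2r //; lra.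
by move=> /(lerD IH) /le_trans; apply; rewrite addrA subrK.
Qed.

Lemma size_coprime_pairs (X Y : nat) : (X * Y <= 4 * size (coprime_pairs X Y))%N.
Proof.
have [->|X0] := posnP X; first by rewrite mul0n.
have sizeE : size (coprime_pairs X Y) =
    (\sum_(1 <= a < X.+1) \sum_(1 <= b < Y.+1) (coprime a b))%N.
  rewrite size_filter -sum1_count big_mkcond big_allpairs_dep /index_iota !subn1 /=.
  by apply: eq_bigr => a _; apply: eq_bigr => b _; case: coprime.
(* A pair that is not coprime is counted at [d = gcdn a b]. The range runs up to [X + 1] so that for
   [X = n + 1] it is the range of [sum_inv_sqr_le]. *)
have pair a b : (0 < a <= X)%N ->
    (1 <= coprime a b + \sum_(2 <= d < X.+2) (d %| a) * (d %| b))%N.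
  move=> /andP[a0 aX]; have [//|ab] := boolP (coprime a b).
  have g1 : (1 < gcdn a b)%N.
    by rewrite ltn_neqAle eq_sym ab gcdn_gt0 a0.
  have gX : (gcdn a b < X.+2)%N.
    by rewrite ltnS (leq_trans (dvdn_leq a0 (dvdn_gcdl a b))) // (leq_trans aX).
  rewrite (big_rem (gcdn a b)) /=; last by rewrite mem_index_iota g1.
  by rewrite dvdn_gcdl dvdn_gcdr.
have total : (X * Y <= size (coprime_pairs X Y) +
                      \sum_(2 <= d < X.+2) (X %/ d) * (Y %/ d))%N.
  have -> : (X * Y = \sum_(1 <= a < X.+1) \sum_(1 <= b < Y.+1) 1)%N.
    by rewrite !sum_nat_const_nat !subn1 muln1.
  rewrite sizeE; under [X in (_ <= _ + X)%N]eq_bigr => d _ do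
    rewrite (divn_count_dvd d X) big_distrl /=.
  rewrite [X in (_ <= _ + X)%N]exchange_big_nat -big_split /=.
  rewrite big_nat [leqRHS]big_nat; apply: leq_sum => a aX.
  under [X in (_ <= _ + X)%N]eq_bigr => d _ do
    rewrite (divn_count_dvd d Y) big_distrr /=.
  rewrite [X in (_ <= _ + X)%N]exchange_big_nat -big_split /=.
  by apply: leq_sum => b _; apply: pair.
have div_le d Z : (Z %/ d)%:R <= Z%:R / d%:R :> rat.
  have [->|d0] := posnP d; first by rewrite divn0 invr0 mulr0.
  by rewrite ler_pdivlMr ?ltr0n // -natrM ler_nat leq_divM.
have XY0 : 0 <= (X * Y)%:R :> rat by [].
have err : (\sum_(2 <= d < X.+2) (X %/ d) * (Y %/ d))%:R <= (X * Y)%:R * (3 / 4) :> rat.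
  rewrite natr_sum (@le_trans _ _ (\sum_(2 <= d < X.+2) (X * Y)%:R * (d%:R ^- 2))) //.
    apply: ler_sum => d _; rewrite !natrM (le_trans (ler_pM _ _ (div_le d X) (div_le d Y))) //.
    by rewrite mulrACA -expr2 exprVn.
  rewrite -mulr_sumr ler_wpM2l //; case: X X0 {sizeE pair total XY0} => // n _.
  apply: le_trans (sum_inv_sqr_le n) _; rewrite gerBl //.
rewrite -(ler_nat rat) natrM; move: total; rewrite -(ler_nat rat) natrD; move: err.
lra.
Qed.

(** * Packing balls around separated points *)

Definition union_balls {R : realType} (L : seq (R * R)) : set R :=
  [set x | exists2 b, b \in L & `|b.1 - x| < b.2].

Lemma ballP {R : realType} (x r t : R) : ball x r t <-> `|x - t| < r.
Proof. by rewrite -ball_normE. Qed.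

Lemma measurable_union_balls {R : realType} (L : seq (R * R)) :
  measurable (union_balls L).
Proof.
elim: L => [|b L IH].
  rewrite (_ : union_balls _ = set0) //.
  by rewrite -subset0 => x [b]; rewrite in_nil.
rewrite (_ : union_balls _ = ball b.1 b.2 `|` union_balls L).
  by apply: measurableU => //; rewrite ball_itv; exact: measurable_itv.
apply/seteqP; split=> x /=.
  by case=> c; rewrite inE => /predU1P[->|cL] cx; [left; apply/ballP|right; exists c].
case=> [/ballP bx|[c cL cx]]; [exists b|exists c] => //; by rewrite inE ?eqxx ?cL ?orbT.
Qed.

(** The separation makes the open balls of radius [h] around these points, called cells, pairwise
    disjoint. *)
Definition spread {R : realType} (h : R) (D : seq R) :=
  uniq D /\ {in D &, forall x z, x != z -> 2 * h <= `|x - z|}.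

Lemma spread_filter {R : realType} (h : R) (D : seq R) (p : pred R) :
  spread h D -> spread h (seq.filter p D).
Proof.
move=> [uD sD]; split; first exact: filter_uniq.
by move=> x z; rewrite !mem_filter => /andP[_ xD] /andP[_ zD]; exact: sD.
Qed.

(** Induction on [D] moves one ball at a time into [S]; separation keeps the remaining balls
    disjoint from the enlarged set. *)
Lemma measure_spread {R : realType} (r : R) (D : seq R) (S V : set R) :
  measurable S -> measurable V -> S `<=` V -> 0 <= r -> spread r D ->
  (forall z, z \in D -> ball z r `<=` V) ->
  (forall z, z \in D -> ball z r `&` S = set0) ->
  (lebesgue_measure S + ((size D)%:R * (2 * r))%:E <= lebesgue_measure V)%E.
Proof.
move=> mS mV + r0; elim: D S mS => [|z D IH] S mS SV sD DV DS.
  by rewrite mul0r adde0; apply: le_measure => //; rewrite inE.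
have zD : z \in z :: D by rewrite inE eqxx.
have DD w : w \in D -> w \in z :: D by rewrite inE orbC => ->.
case: sD => /= /andP[zND uD] sD.
have mB : measurable (ball z r : set R) by rewrite ball_itv; exact: measurable_itv.
apply: le_trans (IH (S `|` ball z r) _ _ _ _ _).
- rewrite measureU //; last by rewrite setIC; exact: DS.
  rewrite -[X in (_ + X + _)%E]/(lebesgue_measure (ball z r)).
  rewrite lebesgue_measure_ball // -addeA -EFinD leeD2l // lee_fin.
  by rewrite -natr1 mulrDl mul1r addrC mulr_natl.
- exact: measurableU.
- by rewrite subUset; split=> //; exact: DV.
- by split=> // x w /DD xD /DD wD; exact: sD.
- by move=> w /DD; exact: DV.
- move=> w wD; rewrite setIUr DS ?DD // set0U -subset0 => t [/ballP wt /ballP zt].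
  have : w != z by apply: contraNneq zND => <-.
  move=> /(sD w z (DD _ wD) zD); apply/negP; rewrite -ltNge.
  by rewrite (le_lt_trans (ler_distD t _ _)) // (distrC t) mulr_natl mulr2n ltrD.
Qed.

(** The cell has an uncovered point [t] and a point [s] inside some ball [b]. On the way from [s] to
    [t] one leaves [b], so an endpoint of [b] lies between them and hence in the cell. *)
Lemma cell_endpoint {R : realType} (L : seq (R * R)) (z h : R) :
  ~ (ball z h `<=` union_balls L) -> ball z h `&` union_balls L !=set0 ->
  exists2 e, e \in [seq b.1 - b.2 | b <- L] ++ [seq b.1 + b.2 | b <- L]
           & `|z - e| < h.
Proof.
move=> /existsNP[t /not_implyP[/ballP zt tL]] [s [/ballP zs [b bL bs]]].
have bt : b.2 <= `|b.1 - t|.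
  by rewrite leNgt; apply/negP => bt; apply: tL; exists b.
have [ts|st] := lerP t b.1.
  exists (b.1 - b.2); first by rewrite mem_cat; apply/orP; left; apply/mapP; exists b.
  move: bt bs zt zs; rewrite ger0_norm ?subr_ge0 // !ltr_norml.
  move=> ? /andP[? ?] /andP[? ?] /andP[? ?]; apply/andP; split; lra.
exists (b.1 + b.2); first by rewrite mem_cat; apply/orP; right; apply/mapP; exists b.
move: bt bs zt zs; rewrite ltr0_norm ?subr_lt0 // !ltr_norml.
move=> ? /andP[? ?] /andP[? ?] /andP[? ?]; apply/andP; split; lra.
Qed.

(* Disjointness of the cells leaves at most [e / (2 h)] of them covered by the
   union of [L] and at most [2 * size L] meeting its boundary; the other points
   of [Q] contribute full new balls. *)
Lemma spread_step {R : realType} (L : seq (R * R)) (Q : seq R) (h r e : R) (V : set R) :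
  measurable V -> union_balls L `<=` V -> 0 < r -> r <= h -> spread h Q ->
  (forall z, z \in Q -> ball z r `<=` V) ->
  (lebesgue_measure (union_balls L) <= e%:E)%E ->
  (lebesgue_measure (union_balls L) +
     (((size Q)%:R - 2 * (size L)%:R - e / (2 * h)) * (2 * r))%:E
   <= lebesgue_measure V)%E.
Proof.
move=> mV LV r0 rh sQ QV Le.
have h0 : 0 < h by exact: lt_le_trans rh.
pose inside z := `[< ball z h `<=` union_balls L >].
pose meets z := `[< ball z h `&` union_balls L !=set0 >].
pose D := seq.filter (predC meets) Q; pose Cn := seq.filter inside Q.
pose E := seq.filter (predD meets inside) Q.
have mL := measurable_union_balls L.
have sizeC : (size Cn)%:R * (2 * h) <= e.
  rewrite -lee_fin; apply: le_trans Le.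
  have := @measure_spread R h Cn set0 (union_balls L) measurable0 mL (@sub0set _ _).
  rewrite measure0 add0e; apply; first exact: ltW.
  - exact: spread_filter.
  - by move=> z; rewrite mem_filter => /andP[/asboolP].
  - by move=> z _; rewrite setI0.
have sizeE : (size E <= 2 * size L)%N.
  pose ends := [seq b.1 - b.2 | b <- L] ++ [seq b.1 + b.2 | b <- L].
  have -> : (2 * size L)%N = size ends by rewrite size_cat !size_map mul2n addnn.
  (* Each boundary cell selects an endpoint, with dummy value 0 off [E]. Two cells sharing an
     endpoint would have centres less than [2 * h] apart, so the selection is injective on [E]. *)
  have HE z : exists e, z \in E -> e \in ends /\ `|z - e| < h.
    have [zE|] := boolP (z \in E); last by exists 0.
    have [e' ? ?] : exists2 e', e' \in ends & `|z - e'| < h.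
      move: zE; rewrite mem_filter => /andP[/andP[/asboolPn ? /asboolP ?] _].
      exact: cell_endpoint.
    by exists e'.
  have [f Hf] := choice HE.
  have fE : {in E, forall z, f z \in ends} by move=> z /Hf[].
  rewrite -(size_map f); apply: uniq_leq_size; last first.
    by move=> _ /mapP[z zE ->]; exact: fE.
  have [uE sE] : spread h E by exact: spread_filter.
  rewrite map_inj_in_uniq // => x w xE wE fxw; apply/eqP/negPn/negP.
  move=> /(sE _ _ xE wE); apply/negP; rewrite -ltNge.
  rewrite (le_lt_trans (ler_distD (f x) _ _)) // {2}fxw (distrC (f w)).
  by rewrite mulr_natl mulr2n ltrD // (Hf _ _).2.
have sizeQ : (size Q <= size D + size Cn + size E)%N.
  rewrite !size_filter; elim: (Q) => //= z s IH.
  by case: (meets z); case: (inside z) => /=; lia.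
have := @measure_spread R r D (union_balls L) V mL mV LV (ltW r0).
move=> H; apply: le_trans (H _ _ _).
- rewrite leeD2l // lee_fin ler_wpM2r //; first by rewrite mulr_ge0 // ltW.
  have Ce : (size Cn)%:R <= e / (2 * h) by rewrite ler_pdivlMr ?mulr_gt0.
  have : (size Q)%:R <= (size D)%:R + (size Cn)%:R + 2 * (size L)%:R :> R.
    by rewrite -natrM -!natrD ler_nat (leq_trans sizeQ) // leq_add2l.
  by move: Ce; lra.
- have [uD sD] : spread h D by exact: spread_filter.
  split=> // x w xD wD xw; apply: le_trans (sD _ _ xD wD xw).
  by rewrite ler_wpM2l.
- by move=> z; rewrite mem_filter => /andP[_]; exact: QV.
- move=> z; rewrite mem_filter => /andP[/asboolPn Hz _].
  rewrite -subset0 => t [zt Lt]; apply: Hz; exists t; split=> //.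
  by apply: le_ball zt.
Qed.
Fixpoint balls_upto {R : realType} (Q : nat -> seq R) (r : nat -> R) (n : nat) : seq (R * R) :=
  if n is k.+1 then balls_upto Q r k ++ [seq (z, r k) | z <- Q k] else [::].

Lemma size_balls_upto {R : realType} (Q : nat -> seq R) (r : nat -> R) (n : nat) :
  size (balls_upto Q r n) = (\sum_(k < n) size (Q k))%N.
Proof. by elim: n => [|n IH]; rewrite ?big_ord0 // big_ord_recr /= size_cat size_map IH. Qed.

Lemma union_balls_cat {R : realType} (L : seq (R * R)) (Q : seq R) (r : R) (V : set R) :
  union_balls L `<=` V -> (forall z, z \in Q -> ball z r `<=` V) ->
  union_balls (L ++ [seq (z, r) | z <- Q]) `<=` V.
Proof.
move=> LV QV t [b]; rewrite mem_cat => /orP[bL bt|]; first by apply: LV; exists b.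
by case/mapP=> z zQ -> /= zt; apply: (QV z zQ); apply/ballP.
Qed.

(** Each summand is the gain that [spread_step] guarantees at level [k] over the balls of all
    earlier levels. The union never leaves [V], so the gains cannot add up to more than [e]. *)
Lemma spread_packing {R : realType} (Q : nat -> seq R) (h r : nat -> R) (V : set R) (e : R) :
  measurable V -> (lebesgue_measure V <= e%:E)%E ->
  (forall k, 0 < r k) -> (forall k, r k <= h k) -> (forall k, spread (h k) (Q k)) ->
  (forall k z, z \in Q k -> ball z (r k) `<=` V) ->
  forall n, \sum_(k < n) (((size (Q k))%:R - 2 * (\sum_(j < k) size (Q j))%:R
                            - e / (2 * h k)) * (2 * r k)) <= e.
Proof.
move=> mV Ve r0 rh sQ QV n.
have LV m : union_balls (balls_upto Q r m) `<=` V.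
  elim: m => [|m IH] /=; first by move=> t [b]; rewrite in_nil.
  by apply: union_balls_cat => //; exact: QV.
have Le m : (lebesgue_measure (union_balls (balls_upto Q r m)) <= e%:E)%E.
  by apply: le_trans Ve; apply: le_measure => //; rewrite inE //; exact: measurable_union_balls.
rewrite -lee_fin; apply: le_trans (Le n).
elim: n => [|n IH]; first by rewrite big_ord0.
rewrite big_ord_recr /= EFinD; apply: le_trans.
  by apply: leeD2r; exact: IH.
rewrite -(size_balls_upto Q r n); apply: spread_step => //.
- exact: measurable_union_balls.
- by move=> t [b bL bt]; exists b => //; rewrite mem_cat bL.
- move=> z zQ t /ballP zt; exists (z, r n) => //.
  by rewrite mem_cat (map_f (fun z => (z, r n))) ?orbT.
Qed.

(** * Farey intervals and their mediants *)

Lemma coprime_pairsP (X Y a b : nat) :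
  (a, b) \in coprime_pairs X Y -> [/\ (0 < a <= X)%N, (0 < b <= Y)%N & coprime a b].
Proof.
rewrite mem_filter => /andP[/= ab /allpairsP[[a' b'] /= [aX bY [E1 E2]]]].
by move: ab aX bY; rewrite E1 E2 !mem_iota !add1n !ltnS => ab aX bY; split.
Qed.

Lemma coprime_cross_inj (a b a' b' : nat) : (0 < a)%N -> (0 < b)%N ->
  coprime a b -> coprime a' b' -> (a * b' = a' * b)%N -> (a, b) = (a', b').
Proof.
move=> a0 b0 ab ab' E.
have -> : a = a'.
  apply/eqP; rewrite eqn_dvd -(Gauss_dvdl _ ab) -E dvdn_mulr //=.
  by rewrite -(Gauss_dvdl _ ab') E dvdn_mulr.
congr pair; apply/eqP; rewrite eqn_dvd -(@Gauss_dvdr b a) 1?coprime_sym // E dvdn_mull //=.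
by rewrite -(@Gauss_dvdr b' a') 1?coprime_sym // -E dvdn_mull.
Qed.

(** Stern-Brocot descent from the unit interval at the floor of [x]: the mediant replaces the
    endpoint on its side of [x]. The determinant is preserved and [q + q'] grows by at least 1. *)
Lemma farey_neighbours {R : realType} (x : R) (l : nat) :
  exists (p p' : int) (q q' : nat), [/\ (0 < q)%N, (0 < q')%N, (l <= q + q')%N,
    p' * q%:Z - p * q'%:Z = 1 & p%:~R <= x * q%:R /\ x * q'%:R < p'%:~R].
Proof.
elim: l => [|l [p [p' [q [q' [q0 q'0 lq det [px xp]]]]]]].
  exists (Num.floor x), (Num.floor x + 1), 1%N, 1%N; split=> //.
    by rewrite !mulr1 addrAC subrr add0r.
  by rewrite !mulr1 floor_le_tmp floorD1_gt.
have [mx|xm] := lerP (p + p')%:~R (x * (q + q')%:R).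
  exists (p + p'), p', (q + q')%N, q'; split=> //; first by rewrite addn_gt0 q0.
    by rewrite -addn1 (leq_trans (leq_add lq q'0)).
  by rewrite PoszD -det; ring.
exists p, (p + p'), q, (q + q')%N; split=> //; first by rewrite addn_gt0 q0.
  by rewrite addnA -add1n (leq_trans (leq_add q0 lq)) // addnA.
by rewrite PoszD -det; ring.
Qed.

Section FareyPoints.
Context {R : realType} (p p' : int) (q q' : nat).
Hypotheses (q0 : (0 < q)%N) (q'0 : (0 < q')%N) (det : p' * q%:Z - p * q'%:Z = 1).

Definition farey_num (ab : nat * nat) : int := ab.1%:Z * p + ab.2%:Z * p'.
Definition farey_den (ab : nat * nat) : nat := (ab.1 * q + ab.2 * q')%N.
Definition farey_point (ab : nat * nat) : R := (farey_num ab)%:~R / (farey_den ab)%:R.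

Lemma farey_den_gt0 (ab : nat * nat) : (0 < ab.1)%N -> (0 < farey_den ab)%N.
Proof. by move=> a0; rewrite addn_gt0 muln_gt0 a0 q0. Qed.

Lemma farey_den_le (T : nat) (ab : nat * nat) :
  ab \in coprime_pairs (q' * T) (q * T) -> (farey_den ab <= 2 * q * q' * T)%N.
Proof.
clear p p' q0 q'0 det; case: ab => a b /coprime_pairsP[/andP[_ aT] /andP[_ bT] _].
rewrite /farey_den /= (leq_trans (leq_add (leq_mul aT (leqnn q)) (leq_mul bT (leqnn q')))) //.
by nia.
Qed.

(** Numerator and denominator are the image of the coefficient pair under a matrix of determinant
    [1] up to sign, so cross determinants are preserved up to sign. *)
Lemma farey_num_cross (ab cd : nat * nat) :
  farey_num ab * (farey_den cd)%:Z - farey_num cd * (farey_den ab)%:Z =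
  cd.1%:Z * ab.2%:Z - ab.1%:Z * cd.2%:Z.
Proof.
rewrite /farey_num /farey_den !PoszD !PoszM.
rewrite -[RHS]mulr1 -det; ring.
Qed.

(** The numerator of the difference is, up to sign, the cross determinant of two distinct coprime
    positive pairs, hence a nonzero integer. *)
Lemma farey_point_dist (ab cd : nat * nat) (X Y X' Y' : nat) :
  ab \in coprime_pairs X Y -> cd \in coprime_pairs X' Y' -> ab != cd ->
  ((farey_den ab)%:R * (farey_den cd)%:R)^-1 <= `|farey_point ab - farey_point cd|.
Proof.
move=> abX cdX; have := farey_num_cross ab cd.
case: ab cd abX cdX => a b [c d].
move=> /coprime_pairsP[/andP[a0 _] /andP[b0 _] ab] /coprime_pairsP[/andP[c0 _] /andP[d0 _] cd].
move=> cross ne.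
have n0 : (0 : R) < (farey_den (a, b))%:R by rewrite ltr0n farey_den_gt0.
have m0 : (0 : R) < (farey_den (c, d))%:R by rewrite ltr0n farey_den_gt0.
have -> : farey_point (a, b) - farey_point (c, d) =
    (farey_num (a, b) * (farey_den (c, d))%:Z - farey_num (c, d) * (farey_den (a, b))%:Z)%:~R
    / ((farey_den (a, b))%:R * (farey_den (c, d))%:R).
  by rewrite /farey_point intrB !intrM -!pmulrn; field; rewrite !gt_eqF.
rewrite normrM [`|_^-1|]gtr0_norm ?invr_gt0 ?mulr_gt0 // ler_peMl ?invr_ge0 ?mulr_ge0 ?(ltW n0) ?(ltW m0) //.
rewrite cross /= -intr_norm -(mulr1z (1 : R)) ler_int.
rewrite -gtz0_ge1 normr_gt0.
apply: contraNneq ne => /eqP; rewrite subr_eq0 -!PoszM => /eqP[E].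
by apply/eqP; apply: coprime_cross_inj => //; rewrite -E.
Qed.

Lemma farey_point_itv (x : R) (ab : nat * nat) (X Y : nat) :
  ab \in coprime_pairs X Y -> p%:~R <= x * q%:R -> x * q'%:R < p'%:~R ->
  `|farey_point ab - x| <= (q%:R * q'%:R)^-1.
Proof.
case: ab => a b /coprime_pairsP[/andP[a0 _] /andP[b0 _] _] px xp.
have detR : p'%:~R * q%:R - p%:~R * q'%:R = 1 :> R.
  by rewrite -[RHS]/(1%:~R) -det intrB !intrM -!pmulrn.
have Q : (0 : R) < q%:R by rewrite ltr0n.
have Q' : (0 : R) < q'%:R by rewrite ltr0n.
have A : (0 : R) < a%:R by rewrite ltr0n.
have B : (0 : R) < b%:R by rewrite ltr0n.
rewrite /farey_point /farey_num /farey_den /= natrD !natrM intrD !intrM -!pmulrn.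
move: (p%:~R : R) (p'%:~R : R) (q%:R : R) (q'%:R : R) (a%:R : R) (b%:R : R)
  px xp detR Q Q' A B => P P' u v s t px xp detR Q Q' A B.
have D : 0 < s * u + t * v by rewrite addr_gt0 ?mulr_gt0.
have -> : (s * P + t * P') / (s * u + t * v) - x =
   (t * (P' - x * v) - s * (x * u - P)) / (s * u + t * v).
  by field; rewrite gt_eqF.
(* The determinant identity splits 1 into two nonnegative parts, one for each side of [x], so each
   part is at most 1. *)
have e1 : (P' - x * v) * u + (x * u - P) * v = 1 by rewrite -detR; ring.
have f1 : 0 <= (x * u - P) * v by rewrite mulr_ge0 ?subr_ge0 // ltW.
have f2 : 0 <= (P' - x * v) * u by rewrite mulr_ge0 ?subr_ge0 // ltW.
have g1 : x * u - P <= v^-1 by rewrite -[leRHS]mul1r ler_pdivlMr //; lra.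
have g2 : P' - x * v <= u^-1 by rewrite -[leRHS]mul1r ler_pdivlMr //; lra.
rewrite normrM [`|_^-1|]gtr0_norm ?invr_gt0 // ler_pdivrMr //.
have -> : (u * v)^-1 * (s * u + t * v) = s * v^-1 + t * u^-1.
  by field; rewrite !gt_eqF.
have h1 : s * (x * u - P) <= s * v^-1 by rewrite ler_pM2l.
have h2 : t * (P' - x * v) <= t * u^-1 by rewrite ler_pM2l.
have h3 : 0 <= s * (x * u - P) by rewrite mulr_ge0 ?subr_ge0 // ltW.
have h4 : 0 <= t * (P' - x * v) by rewrite mulr_ge0 ?subr_ge0 // ltW.
by rewrite ler_norml; apply/andP; split; lra.
Qed.

(** All denominators are at most [2 * q * q' * T], which makes the bound of [farey_point_dist]
    uniform. *)
Lemma spread_farey_points (T : nat) (h : R) : (0 < T)%N ->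
  2 * h = ((2 * q * q' * T)%N%:R ^+ 2)^-1 ->
  spread h [seq farey_point ab | ab <- coprime_pairs (q' * T) (q * T)].
Proof.
move=> T0 hE.
have dist ab cd : ab \in coprime_pairs (q' * T) (q * T) ->
    cd \in coprime_pairs (q' * T) (q * T) -> ab != cd ->
    2 * h <= `|farey_point ab - farey_point cd|.
  move=> abT cdT ne; apply: le_trans (farey_point_dist _ _ _ _ _ _ abT cdT ne).
  have den0 ef : ef \in coprime_pairs (q' * T) (q * T) -> (0 : R) < (farey_den ef)%:R.
    by case: ef => e f /coprime_pairsP[/andP[e0 _] _ _]; rewrite ltr0n farey_den_gt0.
  rewrite hE lef_pV2 ?posrE ?mulr_gt0 ?den0 ?exprn_gt0 ?ltr0n ?muln_gt0 ?q0 ?q'0 //.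
  by rewrite expr2 ler_pM // ler_nat farey_den_le.
have h0 : 0 < 2 * h by rewrite hE invr_gt0 exprn_gt0 // ltr0n !muln_gt0 q0 q'0.
split.
  rewrite map_inj_in_uniq; last first.
    move=> ab cd abT cdT E; apply/eqP/negPn/negP => /(dist _ _ abT cdT).
    by rewrite E subrr normr0 leNgt h0.
  by rewrite filter_uniq // allpairs_uniq ?iota_uniq // => -[? ?] [? ?].
move=> x z /mapP[ab abT ->] /mapP[cd cdT ->] ne; apply: dist => //.
by apply: contraNneq ne => ->.
Qed.
End FareyPoints.

(** * The divergence case of Khinchin's theorem *)

(** A tail of the limsup set: a point in all of these sets has approximations with arbitrarily large
    denominators. For denominators 0 and 1 the radius is [0^-1 = 0], so they contribute nothing. *)
Definition well_approx {R : realType} (N : nat) : set R :=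
  [set x | exists2 nm : nat * int, (N <= nm.1)%N &
     `|nm.2%:~R / nm.1%:R - x| < (nm.1%:R ^+ 2 * ln nm.1%:R)^-1].

Lemma measurable_well_approx {R : realType} (N : nat) : measurable (@well_approx R N).
Proof.
apply: open_measurable.
rewrite (_ : well_approx N = \bigcup_(nm in [set nm : nat * int | (N <= nm.1)%N])
   ball (nm.2%:~R / nm.1%:R : R) (nm.1%:R ^+ 2 * ln nm.1%:R)^-1).
  by apply: bigcup_open => nm _; exact: ball_open.
apply/seteqP; split=> x; first by move=> [nm Nn xnm]; exists nm => //; apply/ballP.
by move=> [nm Nn /ballP xnm]; exists nm.
Qed.

Lemma harmonic_unbounded {R : realType} (M : R) :
  exists n, M < \sum_(k < n) k.+1%:R^-1.
Proof.
apply: contrapT => /forallNP H; apply: (@dvg_harmonic R).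
apply: nondecreasing_is_cvgn.
  by apply/nondecreasing_seqP => n; rewrite /series /= big_nat_recr //= lerDl.
exists M => _ [n _ <-]; rewrite /series /= big_mkord leNgt; apply/negP; exact: H.
Qed.

(* [s] is the length of the Farey interval [p/q, p'/q'] around [x].  Level [k]
   uses the mediants [(a p + b p') / (a q + b q')] with [a <= q' 6^k] and
   [b <= q 6^k]; the ratio 6 makes all earlier levels together negligible. *)
Lemma well_approx_density {R : realType} (x : R) (N l : nat) : (1 < N)%N ->
  exists s : R, [/\ 0 < s, s <= l.+1%:R^-1 &
    ~ (lebesgue_measure (well_approx N `&` ball x (2 * s)) <= (s / 64)%:E)%E].
Proof.
(* From $q + q' \ge l + 2 + N$ follow $q q' \ge q + q' - 1 \ge l + 1$, which bounds [s], and
   denominators at least [N] for all mediants. *)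
move=> N1; have [p [p' [q [q' [q0 q'0 lq det [px xp]]]]]] := farey_neighbours x (l.+2 + N)%N.
have qq0 : (0 < q * q')%N by rewrite muln_gt0 q0.
have Q0 : (0 : R) < (q * q')%:R by rewrite ltr0n.
exists (q * q')%:R^-1; split; first by rewrite invr_gt0.
  rewrite lef_pV2 ?posrE ?ltr0n // ler_nat; move: lq q0 q'0; case: q {px det qq0 Q0} => // u.
  by case: q' {xp} => // v; rewrite !mulSn !mulnS; lia.
set s := _^-1; set V := _ `&` _ => Ve.
have s0 : 0 < s by rewrite invr_gt0.
pose T k := (6 ^ k)%N; pose Nk k := (2 * q * q' * T k)%N.
(* [C] is chosen so that [lam k] dominates [ln (Nk k)], by $\ln(2qq') \le 2qq'$ and $\ln 6^k \le
   6k$. The balls of radius [r k] then lie within those of [well_approx]. *)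
pose C : R := 2 * (q * q')%:R + 6.
pose lam k : R := C * k.+1%:R.
pose h k : R := (2 * (Nk k)%:R ^+ 2)^-1.
pose r k : R := (2 * (Nk k)%:R ^+ 2 * lam k)^-1.
pose Q k : seq R := [seq farey_point p p' q q' ab | ab <- coprime_pairs (q' * T k) (q * T k)].
have T0 k : (0 < T k)%N by rewrite expn_gt0.
have Nk0 k : (0 < Nk k)%N by rewrite !muln_gt0 q0 q'0 T0.
have NR0 k : (0 : R) < (Nk k)%:R by rewrite ltr0n.
have C1 : 1 <= C by rewrite /C; lra.
have lam1 k : 1 <= lam k by rewrite mulr_ege1 // ler1n.
have lam0 k : 0 < lam k by exact: lt_le_trans (lam1 k).
have lnN k : ln (Nk k)%:R <= lam k.
  have TR : (0 : R) < (T k)%:R by rewrite ltr0n.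
  rewrite /Nk natrM lnM ?posrE ?ltr0n ?muln_gt0 ?q0 ?q'0 //.
  have e1 : ln (2 * q * q')%:R <= 2 * (q * q')%:R :> R.
    by rewrite -natrM mulnA ltW // ln_sublinear // ltr0n !muln_gt0 q0 q'0.
  have e2 : ln (T k)%:R <= 6 * k%:R :> R.
    rewrite /T natrX lnXn // -[_ *+ k]mulr_natr ler_wpM2r //.
    by rewrite ltW // ln_sublinear.
  apply: le_trans (lerD e1 e2) _; rewrite /lam /C -natr1.
  have : 0 <= (q * q')%:R * k%:R :> R by rewrite mulr_ge0 // ltW.
  by lra.
have N20 k : 0 < 2 * (Nk k)%:R ^+ 2 :> R by rewrite mulr_gt0 // exprn_gt0.
have r0 k : 0 < r k by rewrite invr_gt0 mulr_gt0.
have rh k : r k <= h k.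
  rewrite lef_pV2 ?posrE ?(mulr_gt0 (N20 k) (lam0 k)) //.
  by rewrite ler_peMr // ltW.
have hE k : 2 * h k = ((Nk k)%:R ^+ 2)^-1.
  by rewrite /h; field; rewrite gt_eqF.
have hs k : h k <= s.
  rewrite lef_pV2 ?posrE //.
  rewrite -natrX -natrM ler_nat; apply: (@leq_trans (Nk k)).
    by rewrite /Nk -!mulnA mul2n -addnn mulnA (leq_trans _ (leq_addr _ _)) // leq_pmulr.
  by have := Nk0 k; move: (Nk k) => m; nia.
have sQ k : spread (h k) (Q k) by apply: spread_farey_points.
have mV : measurable V.
  apply: measurableI; first exact: measurable_well_approx.
  by rewrite ball_itv; exact: measurable_itv.
have QV k z : z \in Q k -> ball z (r k) `<=` V.
  case/mapP=> ab abT -> t /ballP zt; split.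
    exists (farey_den q q' ab, farey_num p p' ab) => /=.
      case: ab abT {zt} => a b /coprime_pairsP[/andP[a0 _] /andP[b0 _] _].
      rewrite /farey_den /= (leq_trans (leq_addl l.+2 N)) // (leq_trans lq) //.
      by rewrite leq_add // leq_pmull.
    apply: lt_le_trans zt _.
    have dN := farey_den_le q q' (T k) ab abT.
    have d1 : (1 < farey_den q q' ab)%N.
      case: ab abT {dN} => a b /coprime_pairsP[/andP[a0 _] /andP[b0 _] _].
      by rewrite /farey_den /=; nia.
    have ln0 : 0 < ln (farey_den q q' ab)%:R :> R by rewrite ln_gt0 // ltr1n.
    rewrite lef_pV2 ?posrE ?(mulr_gt0 (N20 k) (lam0 k)) ?mulr_gt0 ?exprn_gt0 ?ltr0n ?(ltnW d1) //.
    have le1 : (farey_den q q' ab)%:R ^+ 2 <= 2 * (Nk k)%:R ^+ 2 :> R.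
      by rewrite -!natrX -natrM ler_nat (@leq_trans (Nk k ^ 2)%N) ?leq_pmull // leq_sqr.
    apply: ler_pM le1 _; [by rewrite exprn_ge0|exact: ltW|].
    apply: le_trans (lnN k); rewrite ler_ln ?posrE ?ltr0n ?(ltnW d1) //.
    by rewrite ler_nat.
  apply/ballP; rewrite (le_lt_trans (ler_distD (farey_point p p' q q' ab) _ _)) //.
  have := farey_point_itv p p' q q' q0 q'0 det x ab _ _ abT px xp.
  rewrite -natrM -/s => zx; rewrite distrC mulr_natl mulr2n ler_ltD //.
  exact: lt_le_trans zt (le_trans (rh k) (hs k)).
have := spread_packing Q h r V (s / 64) mV Ve r0 rh sQ QV.
(* The factor [32 * (q * q')%:R * C] normalises the gain of level [k] to at least [k.+1%:R^-1]. *)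
have [n Hn] := harmonic_unbounded (s / 64 * (32 * (q * q')%:R * C)).
move=> /(_ n); apply/negP; rewrite -ltNge.
have C0 : 0 < 32 * (q * q')%:R * C by rewrite !mulr_gt0 //; lra.
rewrite -(ltr_pM2r C0) (lt_le_trans Hn) // mulr_suml; apply: ler_sum => k _.
have sumT m : (35 * \sum_(j < m) T j ^ 2 <= T m ^ 2)%N.
  elim: m => [|m IH]; first by rewrite big_ord0.
  have -> : (T m.+1 ^ 2 = 36 * T m ^ 2)%N by rewrite /T (expnS 6) expnMn.
  by rewrite big_ord_recr /= mulnDr (leq_trans (leq_add IH (leqnn _))) //; lia.
have szle j : (size (Q j) <= q * q' * T j ^ 2)%N.
  rewrite size_map size_filter (leq_trans (count_size _ _)) // size_allpairs !size_iota.
  by nia.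
have szge : (q * q' * T k ^ 2 <= 4 * size (Q k))%N.
  rewrite size_map; apply: leq_trans (size_coprime_pairs _ _).
  by nia.
have szsum : (35 * \sum_(j < k) size (Q j) <= q * q' * T k ^ 2)%N.
  apply: (@leq_trans (35 * \sum_(j < k) (q * q' * T j ^ 2))%N).
    by rewrite leq_mul2l /=; apply: leq_sum => j _.
  by rewrite -big_distrr /= mulnCA leq_mul2l sumT orbT.
have NE : (Nk k)%:R = 2 * (q * q')%:R * (T k)%:R :> R by rewrite /Nk -mulnA -mulnA !natrM; ring.
have TR : (0 : R) < (T k)%:R by rewrite ltr0n.
move: szge szsum; rewrite -!(ler_nat R) ![(_ * _ ^ 2)%:R]natrM [(4 * _)%:R]natrM [(35 * _)%:R]natrM natrX.
rewrite hE /r /lam /s NE.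
have k0 : (0 : R) < k.+1%:R by rewrite ltr0n.
have {}C0 : 0 < C by lra.
move: ((\sum_(j < k) size (Q j))%:R : R) ((size (Q k))%:R : R) ((q * q')%:R : R) ((T k)%:R : R)
  (k.+1%:R : R) Q0 TR k0 => M S u t v u0 t0 v0 szge szsum.
have -> : (S - 2 * M - u^-1 / 64 / ((2 * u * t) ^+ 2)^-1) *
     (2 * (2 * (2 * u * t) ^+ 2 * (C * v))^-1) * (32 * u * C) =
  8 * (S - 2 * M - u * t ^+ 2 / 16) / (u * t ^+ 2) / v.
  by field; rewrite !gt_eqF.
rewrite -[leLHS]mul1r ler_pM2r ?invr_gt0 // ler_pdivlMr ?mulr_gt0 ?exprn_gt0 //.
(* With $w = u t^2$, the bounds $S \ge w/4$ and $M \le w/35$ suffice because $1/4 - 2/35 - 1/16 >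
   1/8$. *)
have w0 : 0 < u * t ^+ 2 by rewrite mulr_gt0 // exprn_gt0.
by move: (u * t ^+ 2) w0 szge szsum => w; lra.
Qed.

Lemma ae_well_approx {R : realType} (N : nat) : (1 < N)%N ->
  {ae (@lebesgue_measure R), forall x, well_approx N x}.
Proof.
move=> N1; have mW := @measurable_well_approx R N.
have := lebesgue_density (measurableC mW).
apply: (@filterS _ _ (ae_filter_ringOfSetsType (@lebesgue_measure R))) => x /= cvx; apply: contrapT => Wx.
(* At a density point of the complement outside the good set, small balls have more than $255/256$
   of their measure in the complement. For the ball of measure [4 * s] this leaves the good set at
   most [s / 64]. *)
have near1 : nbhs (\1_(~` well_approx N) x)%:E (fun u : \bar R => (1 - 1 / 256)%:E < u)%E.
  by apply: open_ereal_gt'; rewrite indicE mem_set // lte_fin -[true%:R]/(1 : R); lra.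
have [d /= d0 Hd] := cvx _ near1.
(* This index gives [s < d / 2], so the ball of radius [2 * s] is within the range of the density
   estimate. *)
have [s [s0 sl]] := well_approx_density x N (Num.truncn (2 * d^-1)) N1.
apply.
have s20 : 0 < 2 * s by rewrite mulr_gt0.
have mB : measurable (ball x (2 * s) : set R) by rewrite ball_itv; exact: measurable_itv.
have muB : lebesgue_measure (ball x (2 * s)) = (4 * s)%:E.
  by rewrite lebesgue_measure_ball ?(ltW s20) // -mulr_natl; congr EFin; ring.
have sd : 2 * s < d.
  have d1 : 0 < 2 * d^-1 by rewrite mulr_gt0 // invr_gt0.
  have := truncnS_gt (2 * d^-1); set u := _.+1%:R in sl * => du.
  have u0 : 0 < u by exact: lt_trans du.
  rewrite -ltr_pdivlMl // (le_lt_trans sl) //.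
  by rewrite -[ltRHS]invrK ltf_pV2 ?posrE ?invr_gt0 ?mulr_gt0 // invfM invrK.
have := Hd (2 * s); rewrite /= sub0r normrN gtr0_norm // => /(_ sd s20).
rewrite muB inver gt_eqF ?mulr_gt0 // lte_pdivlMr ?mulr_gt0 // -EFinM => lb.
have E : (lebesgue_measure (well_approx N `&` ball x (2 * s)) +
          lebesgue_measure (~` well_approx N `&` ball x (2 * s)) = (4 * s)%:E)%E.
  rewrite -muB -measureU //; [|exact: measurableI|exact: measurableI (measurableC _) _|].
    by rewrite -setIUl setUv setTI.
  by rewrite setIACA setICr set0I.
have : (lebesgue_measure (well_approx N `&` ball x (2 * s)) +
   ((1 - 1 / 256) * (4 * s))%:E <= (4 * s)%:E)%E.
  by rewrite -E leeD2l // ltW.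
rewrite -leeBrDr // -EFinB => /le_trans; apply; rewrite lee_fin; lra.
Qed.

(** * From rational approximation to the distance of the orbit *)

Lemma ln_le_distRn {R : realType} (z0 : R * R) (n : nat) (m : int) (x y beta C1 C2 : R) :
  let L : R := ln n%:R in let g := Num.min beta (2 - beta) in
  inH z0 -> (0 < n)%N -> 1 <= L -> 0 < C1 -> 0 < C2 ->
  `|m%:~R / n%:R - x| < (n%:R ^+ 2 * L)^-1 ->
  C1 / (n%:R ^+ 2 * L `^ beta) <= y -> y <= C2 / (n%:R ^+ 2 * L `^ beta) ->
  ln (C1 / (2 * Num.max z0.2 z0.2^-1 * (1 + C2 ^+ 2))) + g * ln L <= distRn z0 n x y.
Proof.
move=> L g hz0 n0 L1 C10 C20 xm yl yu.
have L0 : 0 < L by exact: lt_le_trans L1.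
have N0 : (0 : R) < n%:R by rewrite ltr0n.
have b0 : 0 < L `^ beta by rewrite powR_gt0.
have h0 : 0 < Num.max z0.2 z0.2^-1.
  by have z00 : 0 < z0.2 := hz0; rewrite lt_max z00.
have y0 : 0 < y by apply: lt_le_trans yl; rewrite divr_gt0 // mulr_gt0 // exprn_gt0.
have D0 : 0 < 1 + C2 ^+ 2 by rewrite ltr_pwDl ?sqr_ge0.
have c0 : 0 < C1 / (2 * Num.max z0.2 z0.2^-1 * (1 + C2 ^+ 2)).
  by rewrite divr_gt0 // !mulr_gt0.
apply: lb_le_inf; first by exists (dM z0 (x + 0%:R / n%:R, y)); exists (x + 0%:R / n%:R, y) => //; exists 0%N.
move=> _ [_ [j jn <-] <-].
have nz : n%:Z != 0 by rewrite eqz_nat -lt0n.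
have hz : inH (x + j%:R / n%:R, y) by exact: y0.
apply: le_trans (ln_le_dM n%:Z (m + j%:Z) z0 _ hz0 hz nz).
rewrite -ln_powR -lnM ?posrE ?powR_gt0 //.
have nw := cusp_norm_gt0 n%:Z%:~R (m + j%:Z)%:~R _ hz.
rewrite intr_eq0 nz in nw; have {}nw := nw isT.
have d0 : 0 < 2 * Num.max z0.2 z0.2^-1 * cusp_norm n%:Z%:~R (m + j%:Z)%:~R (x + j%:R / n%:R, y).
  by rewrite !mulr_gt0.
rewrite ler_ln ?posrE ?(mulr_gt0 c0) ?powR_gt0 ?(divr_gt0 y0 d0) //=.
rewrite ler_pdivlMr ?mulr_gt0 //.
(* The shift by [j / n] cancels against the shift of the numerator, so the norm is the same for all
   [j]. *)
have -> : cusp_norm n%:Z%:~R (m + j%:Z)%:~R (x + j%:R / n%:R, y) =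
    n%:R ^+ 2 * ((m%:~R / n%:R - x) ^+ 2 + y ^+ 2).
  by rewrite /cusp_norm /= intrD -!pmulrn; field; rewrite gt_eqF.
(* [P] is a common majorant of $L^{-2}$, from the error in [x], and $L^{-2\beta}$, from the height
   [y]. The two comparisons use $g \le 2 - \beta$ and $g \le \beta$, whence the minimum. *)
pose P := L `^ (- (beta + g)).
have P0 : 0 < P by rewrite powR_gt0.
have PL : L `^ g * P = (L `^ beta)^-1.
  rewrite /P -powRD; last by apply/implyP => _; rewrite gt_eqF.
  by rewrite -powRN; congr powR; ring.
have P1 : (L ^+ 2)^-1 <= P.
  rewrite -powR_mulrn ?(ltW L0) // -powRN ler_powR //.
  have : g <= 2 - beta by rewrite ge_min lexx orbT.
  by lra.
have P2 : ((L `^ beta) ^+ 2)^-1 <= P.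
  rewrite -powR_mulrn ?(ltW b0) // -powRrM -powRN ler_powR //.
  have : g <= beta by rewrite ge_min lexx.
  by lra.
have n4 : n%:R ^+ 4 = (n%:R ^+ 2) ^+ 2 :> R by rewrite -exprM.
have e1 : (m%:~R / n%:R - x) ^+ 2 <= (n%:R ^+ 4)^-1 * P.
  apply: (@le_trans _ _ ((n%:R ^+ 4)^-1 * (L ^+ 2)^-1)); last first.
    by rewrite ler_wpM2l // invr_ge0 exprn_ge0 // ltW.
  rewrite -invfM -real_normK ?num_real // n4 -exprMn -exprVn.
  by rewrite ler_sqr ?nnegrE ?invr_ge0 ?mulr_ge0 ?exprn_ge0 ?(ltW L0) ?(ltW N0) ?(ltW xm).
have e2 : y ^+ 2 <= (n%:R ^+ 4)^-1 * (C2 ^+ 2 * P).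
  apply: (@le_trans _ _ ((n%:R ^+ 4)^-1 * (C2 ^+ 2 * ((L `^ beta) ^+ 2)^-1))); last first.
    by rewrite ler_wpM2l ?invr_ge0 ?exprn_ge0 ?(ltW N0) // ler_wpM2l // sqr_ge0.
  rewrite mulrCA -invfM n4 -exprMn -exprVn -exprMn.
  by rewrite ler_sqr ?nnegrE ?(ltW y0) // (le_trans (ltW y0)).
apply: le_trans yl.
apply: (@le_trans _ _ (C1 / (2 * Num.max z0.2 z0.2^-1 * (1 + C2 ^+ 2)) * L `^ g *
   (2 * Num.max z0.2 z0.2^-1 * (n%:R ^+ 2 * ((n%:R ^+ 4)^-1 * P + (n%:R ^+ 4)^-1 * (C2 ^+ 2 * P)))))).
  rewrite ler_wpM2l ?mulr_ge0 ?invr_ge0 ?powR_ge0 ?mulr_ge0 ?(ltW C10) ?(ltW h0) ?(ltW D0) //.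
  rewrite ler_wpM2l ?mulr_ge0 ?(ltW h0) // ler_wpM2l ?sqr_ge0 //.
  exact: lerD.
apply: (@le_trans _ _ (C1 / n%:R ^+ 2 * (L `^ g * P))); last by rewrite PL -mulrA -invfM.
move: (L `^ g) => G; rewrite le_eqVlt; apply/orP; left; apply/eqP.
by field; rewrite !gt_eqF.
Qed.
Lemma limn_esup_ge {R : realType} (u : nat -> R) (g : R) :
  (forall (e : R) (N : nat), 0 < e -> exists2 n, (N <= n)%N & g - e <= u n) ->
  (g%:E <= limn_esup (fun n => (u n)%:E))%E.
Proof.
move=> H; apply/ereal_infP => _ [V [N _ NV] <-]; apply/lee_addgt0Pr => e e0.
have [n Nn gu] := H e N e0.
rewrite -leeBlDr // -EFinB; apply: (@le_trans _ _ (u n)%:E); first by rewrite lee_fin.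
by apply: ereal_sup_ubound; exists n => //; exact: NV.
Qed.

Theorem theorem1p4 (R : realType) (z0 : R * R) (y : nat -> R) (beta : R) :
  inH z0 ->
  0 < beta -> beta < 2 ->
  (forall n, 0 < y n) ->
  (exists (N : nat) (C1 C2 : R), 0 < C1 /\ 0 < C2 /\
     forall n : nat, (N <= n)%N ->
       C1 / (n%:R ^+ 2 * (ln (n%:R : R)) `^ beta) <= y n /\
       y n <= C2 / (n%:R ^+ 2 * (ln (n%:R : R)) `^ beta)) ->
  {ae (@lebesgue_measure R), forall x : R, x \in `[0, 1[ ->
     (limn_esup (fun n : nat =>
        (distRn z0 n x (y n) / ln (ln (n%:R : R)))%:E)
      >= (Num.min beta (2 - beta))%:E)%E}.
Proof.
move=> hz0 _ _ _ [N [C1 [C2 [C10 [C20 yN]]]]].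
have ae_all : {ae (@lebesgue_measure R), forall x, forall M, well_approx M.+2 x}.
  by apply: ae_foralln => M; apply: ae_well_approx.
apply: (@filterS _ _ (ae_filter_ringOfSetsType (@lebesgue_measure R)) _ _ _ ae_all) => x xW _.
apply: limn_esup_ge => e N' e0.
set g := Num.min _ _.
pose c := ln (C1 / (2 * Num.max z0.2 z0.2^-1 * (1 + C2 ^+ 2))).
(* Once [ln (ln n)] reaches [K] it is positive and the additive constant satisfies
   [|c| <= e * ln (ln n)]. The double exponential in the choice of [n] ensures this. *)
pose K := 1 + `|c| / e.
have K1 : 1 <= K by rewrite lerDl divr_ge0 // ltW.
have [[n m] /= Mn xm] := xW (N + N' + Num.truncn (expR (expR K)))%N.
have /andP[Nn N'n] : (N <= n)%N && (N' <= n)%N.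
  by apply/andP; split; apply: leq_trans Mn; lia.
exists n => //.
have n0 : (0 < n)%N by apply: leq_trans Mn.
have nR : (0 : R) < n%:R by rewrite ltr0n.
have Kn : expR (expR K) <= n%:R.
  apply: le_trans (ltW (truncnS_gt _)) _; rewrite ler_nat.
  by apply: leq_trans Mn; rewrite ltnS leqW // leq_addl.
have LK : expR K <= ln n%:R by rewrite -[leLHS]expRK ler_ln ?posrE ?expR_gt0.
have L1 : 1 <= ln n%:R :> R.
  by apply: le_trans LK; rewrite -expR0 ler_expR (le_trans ler01).
have lnLK : K <= ln (ln n%:R) by rewrite -[leLHS]expRK ler_ln ?posrE ?expR_gt0 // (lt_le_trans _ L1).
have lnL0 : 0 < ln (ln n%:R) :> R by apply: lt_le_trans lnLK; apply: lt_le_trans K1.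
have [yl yu] := yN n Nn.
have := ln_le_distRn z0 n m x (y n) beta C1 C2 hz0 n0 L1 C10 C20 xm yl yu.
rewrite -/c -/g => dist; rewrite ler_pdivlMr // (le_trans _ dist) // mulrBl addrC lerD2r.
have ce : `|c| <= e * ln (ln n%:R).
  by rewrite -ler_pdivrMl // mulrC (le_trans _ lnLK) // /K lerDr.
by rewrite lerNl (le_trans _ ce) // ler_normr lexx orbT.
Qed.
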